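(* Let $b\in(0,1]$ and assume $\tau=\{t_k\}_{k=1}^\infty$, $t_k\in[0,1]$, is a nonincreasing weakness sequence. For any (real) Hilbert space $H$ we have $$\gamma_m^{\tau,b}(\alpha,H)\le\left(1+b(2-b)\sum_{k=1}^m t_k^2\right)^{-\alpha/2},$$ provided $\alpha\le \frac{(2-b)t_m}{(2-b)t_m+2}$. Here $$\gamma_m^{\tau,b}(\alpha,H):=\sup_{\mathcal{D}}\ \sup_{f\in A_1(\mathcal{D}),\,f\ne0}\ \sup_{G_m^{\tau,b}(f,\mathcal{D})}\frac{\|f-G_m^{\tau,b}(f,\mathcal{D})\|}{\|f\|^{1-\alpha}\,\|f\|_{A_1(\mathcal{D})}^{\alpha}},$$ the suprema being taken over all dictionaries $\mathcal{D}$ in $H$, all nonzero $f\in A_1(\mathcal{D})$, and all realizations $G_m^{\tau,b}(f,\mathcal{D})$ of the Weak Greedy Algorithm with parameter $b$, WGA($\mathcal{D},\tau,b$).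
   Context: $H$ is a real Hilbert space with inner product $\langle\cdot,\cdot\rangle$ and norm $\|x\|=\langle x,x\rangle^{1/2}$. A dictionary is a set $\mathcal{D}\subset H$ such that $\|g\|=1$ for every $g\in\mathcal{D}$ and the closure of the linear span of $\mathcal{D}$ is $H$. $A_1(\mathcal{D})$ is the closure in $H$ of the convex hull of $\{\pm g: g\in\mathcal{D}\}$, and $\|f\|_{A_1(\mathcal{D})}=\inf\{M>0: f/M\in A_1(\mathcal{D})\}$. A weakness sequence is a sequence $\tau=\{t_k\}_{k=1}^\infty$ of numbers $t_k\in[0,1]$. Weak Greedy Algorithm with parameter $b$, WGA($\mathcal{D},\tau,b$): given $f\in H$, put $f_0=f$. For each $m\ge1$, inductively: (1) $\varphi_m\in\mathcal{D}$ is any element satisfying $|\langle f_{m-1},\varphi_m\rangle|\ge t_m\sup_{g\in\mathcal{D}}|\langle f_{m-1},g\rangle|$ (if $t_m=1$ it is assumed that such a maximizer exists); (2) $f_m=f_{m-1}-b\langle f_{m-1},\varphi_m\rangle\varphi_m$; (3) $G_m^{\tau,b}(f,\mathcal{D})=b\sum_{j=1}^m\langle f_{j-1},\varphi_j\rangle\varphi_j$. Thus $f_m=f-G_m^{\tau,b}(f,\mathcal{D})$. A realization is any outcome of admissible choices of the $\varphi_j$.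
   Formalization: The formal theorem assumes α ≥ 0; for α < 0 the claim fails (t_k = 0, orthonormal basis of R^3, f = (e1+e2)/2, φ_k = e3: the ratio is 2^{-α/2} > 1 while the bound is 1). *)

(* Defs.v *)
From mathcomp Require Import all_boot all_order all_algebra.
From mathcomp Require Import boolp classical_sets reals ereal topology convex.
From mathcomp Require Import normedtype exp.

Set Implicit Arguments.
Unset Strict Implicit.
Unset Printing Implicit Defensive.

Import Order.TTheory GRing.Theory Num.Theory.
Import numFieldNormedType.Exports.

Local Open Scope classical_set_scope.
Local Open Scope ring_scope.

Section Greedy.
Context {R : realType} {H : completeNormedModType R}.

(* A real Hilbert space is a complete normed module together with a symmetric
   positive definite bilinear form inducing its norm. *)
Definition induces_norm (dot : {dot H for idfun}) : Prop :=
  forall x : H, `|x| = Num.sqrt (dot x x).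

Definition linear_span (D : set H) : set H :=
  [set x | exists (n : nat) (c : 'I_n -> R) (g : 'I_n -> H),
     (forall i, D (g i)) /\ x = \sum_(i < n) c i *: g i].

Definition convex_hull (A : set H) : set H := smallest (@convex_set R H) A.

Definition dictionary (D : set H) : Prop :=
  (forall g, D g -> `|g| = 1) /\ closure (linear_span D) = setT.

Definition A1 (D : set H) : set H :=
  closure (convex_hull (D `|` [set - g | g in D])).

(* A real-valued infimum: meaningful when some multiple of f lies in A1 D, in
   particular for f in A1 D, where M = 1 is admissible. *)
Definition A1_norm (D : set H) (f : H) : R :=
  inf [set M : R | 0 < M /\ A1 D (M^-1 *: f)].

(* Only the values t k with 1 <= k are part of the sequence. *)
Definition weakness_sequence (t : nat -> R) : Prop :=
  forall k, (1 <= k)%N -> 0 <= t k <= 1.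

Definition nonincreasing_weakness (t : nat -> R) : Prop :=
  forall j k, (1 <= j <= k)%N -> t k <= t j.

Section WGA.
Variables (dot : {dot H for idfun}) (t : nat -> R) (b : R).

(* The chosen elements are phi 1, phi 2, ...; phi 0 is never used. *)
Fixpoint wga_residual (f : H) (phi : nat -> H) (m : nat) : H :=
  if m is k.+1 then
    let r := wga_residual f phi k in r - (b * dot r (phi k.+1)) *: phi k.+1
  else f.

Definition wga_approx (f : H) (phi : nat -> H) (m : nat) : H :=
  b *: \sum_(1 <= j < m.+1) dot (wga_residual f phi j.-1) (phi j) *: phi j.

(* For t k = 1 the inequality says that phi k attains the supremum, so there
   is no admissible choice when the supremum is not attained. *)
Definition wga_admissible (D : set H) (f : H) (m : nat) (phi : nat -> H) :=
  forall k, (1 <= k <= m)%N ->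
    D (phi k) /\
    t k * sup [set `|dot (wga_residual f phi k.-1) g| | g in D]
      <= `|dot (wga_residual f phi k.-1) (phi k)|.

Definition wga_realizations (D : set H) (f : H) (m : nat) : set H :=
  [set wga_approx f phi m | phi in wga_admissible D f m].

(* Suprema in the extended reals, with -oo as the supremum of the empty set. *)
Definition wga_gamma (m : nat) (alpha : R) : \bar R :=
  ereal_sup [set
    ereal_sup [set
      ereal_sup [set
        (`|f - G| / (`|f| `^ (1 - alpha) * A1_norm D f `^ alpha))%:E
      | G in wga_realizations D f m]
    | f in [set f | A1 D f /\ f != 0]]
  | D in dictionary].

End WGA.

End Greedy.

(* Main.v *)
(* Put a_k = |f_k|^2, y_k = |<f_(k-1), phi_k>|, M = |f|_(A_1) and
   B_k = M + b (y_1 + ... + y_k), so that f_k / B_k lies in A_1. Testing f_(k-1)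
   against itself gives y_k >= t_k a_(k-1) / B_(k-1), while
   a_k = a_(k-1) - b (2 - b) y_k^2. Bounding both factors y_k below yields
   a_m (1 + b (2 - b) (t_1^2 + ... + t_m^2)) <= B_m^2; bounding only one, and
   using t_k >= t_m, shows that a_k B_k^((2 - b) t_m) is nonincreasing. The two
   estimates together eliminate the uncontrolled B_m and give the claim for the
   largest alpha; smaller exponents follow by interpolating with a_m <= a_0. *)

Require Import Defs.
From mathcomp Require Import all_boot all_order all_algebra.
From mathcomp Require Import boolp classical_sets reals ereal topology convex.
From mathcomp Require Import normedtype exp.
From mathcomp Require Import lra ring.
Import Order.TTheory GRing.Theory Num.Theory.
Import numFieldNormedType.Exports.
Local Open Scope ring_scope.

(** * Scalar recursions and their logarithms *)

(** In terms of z_k = a_k / B_k^2 the claim bounds z_k by the inverse of 1 + c (s_0^2 + ... +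
    s_(k-1)^2); the product form also covers a_k = 0. Positivity of B is carried along for the
    division. *)
Lemma quadratic_decrease_le (R : realType) (c : R) (s y a B : nat -> R) (m : nat) :
  0 <= c -> 0 < B 0 -> a 0 <= B 0 ^+ 2 ->
  (forall k, (k <= m)%N -> 0 <= a k) ->
  (forall k, (k < m)%N -> [/\ 0 <= s k, 0 <= y k, B k <= B k.+1,
     s k * a k <= y k * B k & a k.+1 = a k - c * y k ^+ 2]) ->
  (1 + c * \sum_(0 <= k < m) s k ^+ 2) * a m <= B m ^+ 2 /\ 0 < B m.
Proof.
move=> c0 B0 aB0; elim: m => [|m IH] a0 step.
  by rewrite big_geq // mulr0 addr0 mul1r.
have [|| IHa Bm] := IH.
- by move=> k km; apply: a0; exact: leqW.
- by move=> k km; apply: step; exact: leqW.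
have [s0 y0 BB sa aE] := step m (ltnSn m).
split; last exact: lt_le_trans Bm BB.
have am1 : 0 <= a m.+1 by exact: a0.
have am : 0 <= a m by exact/a0/leqW.
apply: (@le_trans _ _ (B m ^+ 2)); last first.
  by rewrite ler_sqr // nnegrE ltW // (lt_le_trans Bm).
rewrite big_nat_recr //= mulrDr addrA.
set L := 1 + _ in IHa *.
have Bm0 := ltW Bm.
have Bm2 : 0 < B m ^+ 2 by rewrite exprn_gt0.
set w := c * s m ^+ 2.
have w0 : 0 <= w by rewrite mulr_ge0 // sqr_ge0.
set z := a m / B m ^+ 2.
have z0 : 0 <= z by rewrite divr_ge0 // ltW.
have Lz : L * z <= 1 by rewrite mulrA ler_pdivrMr // mul1r.
have azE : a m = z * B m ^+ 2 by rewrite /z divfK // gt_eqF.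
clearbody z.
(* Both factors of y_m^2 are replaced by their lower bound s_m z B_m. *)
have a1 : a m.+1 <= z * B m ^+ 2 * (1 - w * z).
  have -> : z * B m ^+ 2 * (1 - w * z) = a m - c * (s m * (z * B m)) ^+ 2.
    by rewrite azE /w; ring.
  rewrite aE lerD2l lerN2 ler_wpM2l // ler_sqr ?nnegrE ?mulr_ge0 //.
  by rewrite -(ler_pM2r Bm) (le_trans _ sa) // azE; lra.
(* Hence z' <= z (1 - w z) for z = a / B^2, so 1 / z grows by at least w. *)
have wz1 : 0 <= z * (1 - w * z).
  rewrite -(pmulr_rge0 _ Bm2).
  by apply: le_trans am1 _; rewrite (le_trans a1) //; lra.
have L0 : 0 <= L.
  rewrite addr_ge0 // mulr_ge0 // sumr_ge0 // => k _; exact: sqr_ge0.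
apply: (@le_trans _ _ ((L + w) * (z * B m ^+ 2 * (1 - w * z)))).
  by rewrite ler_wpM2l // addr_ge0.
rewrite -[leRHS]mul1r.
have -> : (L + w) * (z * B m ^+ 2 * (1 - w * z)) =
  ((L + w) * (z * (1 - w * z))) * B m ^+ 2 by ring.
rewrite ler_pM2r //.
have [wz | wz] := lerP (w * z) 1; last first.
  have -> : z * (1 - w * z) = 0.
    apply/eqP; rewrite eq_le wz1 andbT mulr_ge0_le0 // subr_le0; exact: ltW.
  by rewrite mulr0.
(* As L z <= 1, the left side of the goal is at most (1 + w z) (1 - w z) = 1 - (w z)^2. *)
have : 0 <= (1 - L * z) * (1 - w * z) by rewrite mulr_ge0 // subr_ge0.
have := sqr_ge0 (w * z); nra.
Qed.

(** Logarithms make the monotonicity of a_k B_k^v, v = (2 - b) s, a linear inequality. Positivity of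
    a at the last index passes back to earlier ones, since a does not increase. *)
Lemma weighted_log_decrease (R : realType) (b s : R) (y a B : nat -> R) (m : nat) :
  0 < b -> b <= 1 -> 0 <= s -> 0 < B 0 -> 0 < a m ->
  (forall k, (k < m)%N -> [/\ 0 <= y k, B k.+1 = B k + b * y k,
     s * a k <= y k * B k & a k.+1 = a k - b * (2 - b) * y k ^+ 2]) ->
  ln (a m) + (2 - b) * s * ln (B m) <= ln (a 0) + (2 - b) * s * ln (B 0)
  /\ 0 < B m.
Proof.
move=> b0 b1 s0 B0.
have b2 : 0 <= 2 - b by lra.
have c0 : 0 <= b * (2 - b) by rewrite mulr_ge0 // ltW.
elim: m => [//|m IH] am1 step.
have [y0 BE sa aE] := step m (ltnSn m).
have am : 0 < a m.
  apply: lt_le_trans am1 _; rewrite aE lerBlDr lerDl.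
  by rewrite mulr_ge0 // sqr_ge0.
have [|IHa Bm] := IH am; first by move=> k km; apply: step; exact: leqW.
have Bm1 : 0 < B m.+1 by rewrite BE ltr_wpDr // mulr_ge0 // ltW.
split=> //; apply: le_trans IHa.
set u := b * y m / B m.
have u0 : 0 <= u by rewrite divr_ge0 ?mulr_ge0 // ltW.
set v := (2 - b) * s.
have v0 : 0 <= v by rewrite mulr_ge0.
have -> : B m.+1 = B m * (1 + u) by rewrite BE /u; field; rewrite gt_eqF.
(* Only one factor of y_m^2 is replaced by its lower bound s a_m / B_m; with u the relative growth
   of B, the loss is at least v u a_m. *)
have a1 : a m.+1 <= a m * (1 + - (v * u)).
  have -> : a m * (1 + - (v * u)) = a m - b * (2 - b) * y m * (s * a m / B m).
    by rewrite /v /u; field; rewrite gt_eqF.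
  rewrite aE lerD2l lerN2 expr2 [leRHS]mulrA; apply: ler_wpM2l; first exact: mulr_ge0.
  by rewrite ler_pdivrMr.
(* Hence a_m B_m^v does not increase, since ln (1 - v u) + v ln (1 + u) <= 0. *)
have vu : 0 < 1 + - (v * u) by rewrite -(pmulr_rgt0 _ am) (lt_le_trans am1).
have u1 : 0 < 1 + u by rewrite ltr_wpDr.
rewrite lnM ?posrE //.
have l1 : ln (a m.+1) <= ln (a m) + ln (1 + - (v * u)).
  by rewrite -lnM ?posrE // ler_ln ?posrE // mulr_gt0.
have l2 : ln (1 + - (v * u)) <= - (v * u) by rewrite le_ln1Dx //; lra.
have l3 : ln (1 + u) <= u by rewrite le_ln1Dx //; lra.
have := ler_wpM2l v0 l3; lra.
Qed.

(** The variables [lr], [lF], [lM], [lB], [lL] are the logarithms of |f_m|, |f|, M, B_m and L. Twice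
    the estimate with [lM] plus v times the last hypothesis cancels [lB]. *)
Lemma log_interpolation (R : realType) (alpha v lr lF lM lB lL : R) :
  0 <= alpha -> 0 <= v -> alpha <= v / (v + 2) -> lr <= lF ->
  2 * lr + v * lB <= 2 * lF + v * lM -> 2 * lr <= 2 * lB - lL ->
  lr <= (1 - alpha) * lF + alpha * lM - alpha / 2 * lL.
Proof.
move=> al0 v0; rewrite ler_pdivlMr; last lra.
move=> al h1 h2 h3.
have h4 := ler_wpM2l v0 h3.
(* The claim is X + alpha Y >= 0, affine in alpha: at 0 it is X >= 0, and [h5] is its scaled form at
   alpha = v / (v + 2). *)
set X := lF - lr; set Y := lM - lL / 2 - lF.
suff : 0 <= X + alpha * Y by rewrite /X /Y; lra.
have X0 : 0 <= X by rewrite subr_ge0.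
have h5 : 0 <= (v + 2) * X + v * Y by rewrite /X /Y; lra.
have [Y0|Y0] := lerP 0 Y; first by rewrite addr_ge0 // mulr_ge0.
have v2 : 0 < v + 2 by lra.
by rewrite -(pmulr_rge0 _ v2); nra.
Qed.

(** * Inner product estimates on A_1 *)

Section Hilbert.
Context {R : realType} {H : completeNormedModType R}.
Variables (dot : {dot H for idfun}).
Hypothesis dot_norm : induces_norm dot.

Lemma dotC (x y : H) : dot x y = dot y x.
Proof. by rewrite hermC expr0 mul1r. Qed.

Lemma dotxx (x : H) : dot x x = `|x| ^+ 2.
Proof.
rewrite dot_norm sqr_sqrtr //.
have [->|x0] := eqVneq x 0; first by rewrite linear0r.
exact/ltW/neq0_dnorm_gt0.
Qed.

Lemma normD_sqr (x y : H) : `|x + y| ^+ 2 = `|x| ^+ 2 + `|y| ^+ 2 + dot x y *+ 2.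
Proof.
by rewrite -!dotxx linearDl !linearDr /= [dot y x]dotC; ring.
Qed.

(** Cauchy-Schwarz follows by squaring the triangle inequality of the given norm. *)
Lemma dot_le (x y : H) : dot x y <= `|x| * `|y|.
Proof.
have : `|x + y| ^+ 2 <= (`|x| + `|y|) ^+ 2.
  by rewrite ler_sqr ?nnegrE ?addr_ge0 // ler_normD.
by rewrite normD_sqr sqrrD; lra.
Qed.

Lemma norm_dot_le (x y : H) : `|dot x y| <= `|x| * `|y|.
Proof.
rewrite ler_norml dot_le andbT lerNl.
by have := dot_le x (- y); rewrite linearNr normrN.
Qed.

Lemma convex_dot_le (x : H) (s : R) :
  convex_set (R := R) (M := H) [set h | dot x h <= s]%classic.
Proof.
move=> h k l; rewrite !inE /= => hs ks.
rewrite linearDr !linearZr_LR /=.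
have l0 : 0 <= l%:num by [].
have l1 : l%:num <= 1 by [].
rewrite (_ : s = l%:num * s + (1 - l%:num) * s); last by ring.
by apply: lerD; apply: ler_wpM2l => //; rewrite subr_ge0.
Qed.

(** A closed half-space containing all g and -g contains their convex hull, the smallest convex set
    around them, and its closure. *)
Lemma dot_A1_le (D : set H) (x h : H) (s : R) :
  (forall g, D g -> `|dot x g| <= s) -> A1 D h -> dot x h <= s.
Proof.
move=> Ds Ah.
have hull k : convex_hull (D `|` [set - g | g in D])%classic k -> dot x k <= s.
  move=> /(_ [set h | dot x h <= s]%classic); apply; split; first exact: convex_dot_le.
  move=> l [/Ds ls|[g /Ds gs <-]] /=; first exact: le_trans (ler_norm _) ls.
  by rewrite linearNr; apply: le_trans gs; rewrite -normrN ler_norm.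
apply/ler_addgt0Pr => e e0.
(* Adding 1 keeps the radius e / (|x| + 1) meaningful when x = 0. *)
have x1 : 0 < `|x| + 1 by rewrite ltr_wpDl.
have d0 : 0 < e / (`|x| + 1) by rewrite divr_gt0.
have [k [/hull ks]] := Ah _ (nbhsx_ballx h _ d0).
rewrite -ball_normE /= => /ltW hk.
rewrite -(subrK k h) linearDr addrC lerD //.
apply: le_trans (dot_le _ _) _.
apply: (@le_trans _ _ ((`|x| + 1) * (e / (`|x| + 1)))).
  by rewrite ler_pM // lerDl.
by rewrite mulrC divfK // gt_eqF.
Qed.

(** Testing h against itself, with |<h, g>| <= |h|, gives |h|^2 <= |h|. *)
Lemma A1_norm_le1 (D : set H) (h : H) : dictionary D -> A1 D h -> `|h| <= 1.
Proof.
move=> [D1 _] Ah.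
have hh : dot h h <= `|h|.
  apply: dot_A1_le Ah => g /D1 g1.
  by apply: le_trans (norm_dot_le _ _) _; rewrite g1 mulr1.
have [->|h0] := eqVneq h 0; first by rewrite normr0.
have : 0 < `|h| by rewrite normr_gt0.
by move/ler_pM2l => <-; rewrite mulr1 -expr2 -dotxx.
Qed.

Section Norm.
Variables (D : set H) (f : H).
Hypotheses (dD : dictionary D) (Af : A1 D f).

Let S := [set M : R | 0 < M /\ A1 D (M^-1 *: f)]%classic.

Let S1 : S 1. Proof. by split=> //; rewrite invr1 scale1r. Qed.

(** Every admissible M satisfies |f / M| <= 1. This yields both M > 0 for nonzero f and the initial
    condition a_0 <= B_0^2. *)
Lemma le_A1_norm : `|f| <= A1_norm D f.
Proof.
apply: lb_le_inf; first by exists 1; exact: S1.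
move=> M [M0 /(A1_norm_le1 _ _ dD)].
by rewrite normrZ gtr0_norm ?invr_gt0 // mulrC ler_pdivrMr // mul1r.
Qed.

Lemma dot_le_A1_norm (x : H) (s : R) :
  (forall g, D g -> `|dot x g| <= s) -> 0 <= s -> dot x f <= A1_norm D f * s.
Proof.
move=> Ds s0.
have Ms M : S M -> dot x f <= M * s.
  move=> [M0 /(dot_A1_le _ _ _ _ Ds)].
  by rewrite linearZr_LR /= mulrC ler_pdivrMr // mulrC.
(* Dividing by s passes the bound to the infimum; for s = 0 the admissible M = 1 suffices. *)
move: s0; rewrite le_eqVlt => /predU1P[s0|s0].
  by have := Ms 1 S1; rewrite -s0 !mulr0.
rewrite -ler_pdivrMr //; apply: lb_le_inf; first by exists 1; exact: S1.
by move=> M /Ms; rewrite ler_pdivrMr.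
Qed.

End Norm.

(** * Residuals of the greedy algorithm *)

Variables (t : nat -> R) (b : R).

Lemma wga_residualE (f : H) (phi : nat -> H) (m : nat) :
  f - wga_approx dot b f phi m = wga_residual dot b f phi m.
Proof.
rewrite /wga_approx; elim: m => [|m IH]; first by rewrite big_geq // scaler0 subr0.
by rewrite big_nat_recr //= scalerDr opprD addrA IH scalerA.
Qed.

(** The factor b (2 - b) is 2 b - b^2, from the cross term and the square of the correction. *)
Lemma dot_wga_residualS (f : H) (phi : nat -> H) (m : nat)
    (r := wga_residual dot b f phi) :
  `|phi m.+1| = 1 ->
  dot (r m.+1) (r m.+1) =
    dot (r m) (r m) - b * (2 - b) * `|dot (r m) (phi m.+1)| ^+ 2.
Proof.
move=> p1; rewrite {1 2}/r /= -/r; set q := r m; set p := phi m.+1.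
rewrite linearBl !linearBr /= !linearZl_LR /= !linearZr_LR /= [dot p q]dotC.
rewrite (dotxx p) p1 expr1n real_normK ?num_real //; ring.
Qed.

(** Dual form of f_k lying in B_k A_1: each correction is, up to sign, b y_j times a dictionary
    element, so it adds at most b y_j s. *)
Lemma dot_wga_residual_le (D : set H) (f : H) (phi : nat -> H) (x : H) (M s : R)
    (k : nat) :
  0 <= b -> (forall g, D g -> `|dot x g| <= s) -> dot x f <= M * s ->
  (forall j, (j < k)%N -> D (phi j.+1)) ->
  dot x (wga_residual dot b f phi k) <=
    (M + b * \sum_(0 <= j < k)
               `|dot (wga_residual dot b f phi j) (phi j.+1)|) * s.
Proof.
move=> b0 Ds fs; elim: k => [|k IH] Dphi.
  by rewrite big_geq // mulr0 addr0.
have {IH} := IH (fun j jk => Dphi j (leqW jk)).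
rewrite big_nat_recr //= linearBr linearZr_LR /=.
set r := wga_residual _ _ _ _ _; set p := phi _; set Y := \sum_(_ <= _ < _) _.
move=> IH; rewrite mulrDr addrA mulrDl; apply: lerD => //.
apply: (le_trans (ler_norm _)); rewrite normrN !normrM (ger0_norm b0).
by rewrite ler_wpM2l ?mulr_ge0 // Ds //; exact: Dphi.
Qed.

(** The residual is tested against itself with s the supremum over D; the weak selection rule bounds
    t_(k+1) s by |<f_k, phi_(k+1)>|. *)
Lemma wga_step (D : set H) (f : H) (phi : nat -> H) (m k : nat)
    (r := wga_residual dot b f phi) :
  0 <= b -> weakness_sequence t -> dictionary D -> A1 D f ->
  wga_admissible dot t b D f m phi -> (k < m)%N ->
  t k.+1 * dot (r k) (r k) <=
    `|dot (r k) (phi k.+1)| *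
    (A1_norm D f + b * \sum_(0 <= j < k) `|dot (r j) (phi j.+1)|).
Proof.
move=> b0 tw dD Af adm km.
have [Dp ts] := adm k.+1 km.
set T := sup _ in ts.
(* Cauchy-Schwarz bounds the set by |f_k|, so [sup] is a true upper bound and not a default
   value. *)
have Ts g : D g -> `|dot (r k) g| <= T.
  move=> Dg; apply: ub_le_sup; last by exists g.
  exists `|r k| => _ [h Dh <-]; apply: le_trans (norm_dot_le _ _) _.
  by rewrite (dD.1 h Dh) mulr1.
have T0 : 0 <= T by apply: le_trans (Ts _ Dp).
have rB : dot (r k) (r k) <=
    (A1_norm D f + b * \sum_(0 <= j < k) `|dot (r j) (phi j.+1)|) * T.
  apply: (dot_wga_residual_le D) => //; first exact: dot_le_A1_norm.
  by move=> j jk; apply: (adm j.+1 _).1; rewrite /= (ltn_trans jk).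
have /andP[t0 _] := tw k.+1 isT.
apply: le_trans (ler_wpM2l t0 rB) _.
rewrite mulrCA mulrC ler_wpM2r // addr_ge0 //.
  by rewrite (le_trans _ (le_A1_norm _ _ dD Af)).
by rewrite mulr_ge0 // sumr_ge0.
Qed.

Lemma wga_rate (D : set H) (f : H) (phi : nat -> H) (m : nat) (alpha : R) :
  0 < b -> b <= 1 -> weakness_sequence t -> nonincreasing_weakness t ->
  (1 <= m)%N -> 0 <= alpha ->
  alpha <= (2 - b) * t m / ((2 - b) * t m + 2) ->
  dictionary D -> A1 D f -> f != 0 -> wga_admissible dot t b D f m phi ->
  `|wga_residual dot b f phi m| / (`|f| `^ (1 - alpha) * A1_norm D f `^ alpha)
    <= (1 + b * (2 - b) * \sum_(1 <= k < m.+1) t k ^+ 2) `^ (- (alpha / 2)).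
Proof.
move=> b0 b1 tw tn m0 al0 al dD Af f0 adm.
pose r := wga_residual dot b f phi.
(* Indices shift by one: [y k] pairs f_k with phi_(k+1), so it goes with [t k.+1] and sums start at
   0. *)
pose y k := `|dot (r k) (phi k.+1)|.
pose a k := dot (r k) (r k).
pose M := A1_norm D f.
pose B k := M + b * \sum_(0 <= j < k) y j.
have F0 : 0 < `|f| by rewrite normr_gt0.
have fM : `|f| <= M by exact: le_A1_norm.
have M0 : 0 < M := lt_le_trans F0 fM.
have B0E : B 0%N = M by rewrite /B big_geq // mulr0 addr0.
have BE k : B k.+1 = B k + b * y k by rewrite /B big_nat_recr //= mulrDr addrA.
have y0 k : 0 <= y k by exact: normr_ge0.
have a0 k : 0 <= a k by rewrite /a dotxx sqr_ge0.
have c0 : 0 <= b * (2 - b) by rewrite mulr_ge0 ?subr_ge0; lra.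
have sa k : (k < m)%N -> t k.+1 * a k <= y k * B k.
  by move=> km; exact: (wga_step D f phi m k (ltW b0) tw dD Af adm km).
have aE k : (k < m)%N -> a k.+1 = a k - b * (2 - b) * y k ^+ 2.
  by move=> km; apply: dot_wga_residualS; apply: dD.1; have [] := adm k.+1 km.
have t0 k : 0 <= t k.+1 by have /andP[] := tw k.+1 isT.
have tm0 : 0 <= t m by case: (m) m0.
have am_le : a m <= a 0%N.
  have : forall k, (k <= m)%N -> a k <= a 0%N.
    elim=> [//|k IH] km; apply: le_trans (IH (ltnW km)).
    by rewrite aE // lerBlDr lerDl mulr_ge0 // sqr_ge0.
  exact.
rewrite big_add1 /=.
set L := 1 + b * _ * _.
have L1 : 1 <= L.
  by rewrite lerDl mulr_ge0 // sumr_ge0 // => k _; exact: sqr_ge0.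
have L0 : 0 < L by exact: lt_le_trans L1.
(* A zero residual makes the quotient 0 and is set apart before logarithms are taken. *)
have [rm0|rm0] := eqVneq (r m) 0.
  by rewrite -/(r m) rm0 normr0 mul0r powR_ge0.
have Rm : 0 < `|r m| by rewrite normr_gt0.
have am0 : 0 < a m by rewrite /a dotxx exprn_gt0.
have [||||LB Bm] := quadratic_decrease_le _ _ (fun k => t k.+1) y a B m c0.
- by rewrite B0E.
- by rewrite B0E /a dotxx ler_sqr ?nnegrE ?(ltW M0).
- by [].
- by move=> k km; split; rewrite ?sa ?aE ?BE // lerDl mulr_ge0 // ltW.
(* Since t_m <= t_(k+1) for k < m, the constant weight s = t_m serves every step. *)
have [||lnB _] := weighted_log_decrease _ b (t m) y a B m b0 b1 tm0 _ am0.
- by rewrite B0E.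
- move=> k km; split; rewrite ?aE ?BE //; apply: le_trans (sa k km).
  by rewrite ler_wpM2r // tn.
have lna k : 0 < `|r k| -> ln (a k) = 2 * ln `|r k|.
  by move=> rk; rewrite /a dotxx lnXn // mulr_natl.
rewrite !lna // B0E in lnB.
have lnL : 2 * ln `|r m| <= 2 * ln (B m) - ln L.
  have -> : 2 * ln (B m) = ln (B m ^+ 2) by rewrite lnXn // mulr_natl.
  by rewrite -lna // lerBrDl -lnM ?posrE // ler_ln ?posrE ?mulr_gt0 ?exprn_gt0.
have ln_le : ln `|r m| <= ln `|f|.
  rewrite ler_ln ?posrE // -(@ler_pXn2r _ 2) ?nnegrE //.
  by move: am_le; rewrite /a !dotxx.
have v0 : 0 <= (2 - b) * t m by rewrite mulr_ge0 // subr_ge0; lra.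
have := log_interpolation _ alpha _ _ _ _ _ _ al0 v0 al ln_le lnB lnL.
have N0 : 0 < `|f| `^ (1 - alpha) * M `^ alpha by rewrite mulr_gt0 // powR_gt0.
move=> main; rewrite ler_pdivrMr // -ler_ln ?posrE ?mulr_gt0 ?powR_gt0 //.
rewrite !lnM ?posrE ?mulr_gt0 ?powR_gt0 // !ln_powR; lra.
Qed.

End Hilbert.

Theorem theorem2p3 (R : realType) (H : completeNormedModType R)
  (dot : {dot H for idfun}) (dot_norm : induces_norm dot)
  (b : R) (b_gt0 : 0 < b) (b_le1 : b <= 1)
  (t : nat -> R) (t_weak : weakness_sequence t)
  (t_noninc : nonincreasing_weakness t)
  (m : nat) (m_gt0 : (1 <= m)%N)
  (alpha : R) (alpha_ge0 : 0 <= alpha)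
  (alpha_le : alpha <= (2 - b) * t m / ((2 - b) * t m + 2)) :
  (wga_gamma dot t b m alpha
    <= ((1 + b * (2 - b) * \sum_(1 <= k < m.+1) t k ^+ 2)
          `^ (- (alpha / 2)))%:E)%E.
Proof.
apply: ge_ereal_sup => _ [D dD <-].
apply: ge_ereal_sup => _ [f [Af f0] <-].
apply: ge_ereal_sup => _ [_ [phi adm <-] <-].
by rewrite lee_fin wga_residualE; exact: (wga_rate _ dot_norm).
Qed.
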